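(* Let $\lambda=(n-m,m)$ with $0\leqslant m\leqslant n/2$, let $\mathfrak t\in\mathrm{RStd}(\lambda)$, let $e_L\in\mathcal O\subset\mathfrak M_{\mathfrak t}\subset M^\lambda$, where $\mathcal O$ is a $(U^w\cap U)$-orbit of $\mathcal E_{\mathfrak t}$, and let $\mathfrak p=\mathfrak p(\mathcal O)$. Then $L$ is a good filling of the path $\pi_{\mathfrak t}$ if and only if $\mathfrak t\setminus(\mathfrak p_{\mathcal I}\cup\mathfrak p_{\mathcal J})$ is standard.
   Context: $q$ is a power of a prime $p$; $F$ is a field of characteristic different from $p$ containing a primitive $p$-th root of unity; $\theta:(\mathbb F_q,+)\to F^*$ is a fixed nontrivial character. $\mathrm{RStd}(\lambda)$: row-standard $\lambda$-tableaux (entries $1,\dots,n$, increasing along rows); $\mathfrak t$ has first row $a_1<\dots<a_{n-m}$ and second row $\underline{\mathfrak t}=(b_1<\dots<b_m)$. $\mathfrak J_{\mathfrak t}=\{(i,j): i>j,\ i\in\underline{\mathfrak t},\ j\notin\underline{\mathfrak t}\}$. $\Xi_{m,n}$ is the set of $m\times n$ matrices $L$ over $\mathbb F_q$ for which there are $1\le b_1<\dots<b_m\le n$ (used as row labels) such that $l_{b_ib_i}=1$, $l_{b_ij}=0$ for $j>b_i$, and $l_{b_kb_i}=0$ for $k>i$; $\mathrm{tab}(L)$ is the row-standard tableau with second row $(b_1,\dots,b_m)$; the $l_{b_ib_i}$ are the ''last 1's''. $M^\lambda$ is the $F$-space with basis $\Xi_{m,n}$, with right action $[L]\mapsto[L\circ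 g]$ of $GL_n(q)$, where $L\circ g\in\Xi_{m,n}$ is row equivalent to $Lg$. $U$: lower unitriangular matrices in $GL_n(q)$. $\mathfrak X_{\mathfrak t}=\{L:\mathrm{tab}(L)=\mathfrak t\}$, $\mathfrak M_{\mathfrak t}$ its $F$-span. For $L\in\mathfrak X_{\mathfrak t}$, $e_L=q^{-|\mathfrak J_{\mathfrak t}|}\sum_{M\in\mathfrak X_{\mathfrak t}}\prod_{(b,j)\in\mathfrak J_{\mathfrak t}}\theta(-l_{bj}m_{bj})[M]$ and $\mathcal E_{\mathfrak t}=\{e_L:L\in\mathfrak X_{\mathfrak t}\}$. With $w$ the permutation with $\mathfrak t^\lambda w=\mathfrak t$ ($\mathfrak t^\lambda$ contains $1,\dots,n$ in order along the rows), $U^w\cap U=\{g\in U:g_{ij}=0\text{ whenever }i\notin\underline{\mathfrak t},\,j\in\underline{\mathfrak t}\}$; it acts monomially on $\mathcal E_{\mathfrak t}$, and its orbits are meant up to nonzero scalars. A pattern is a set $\mathfrak p=\{(b_i,a_i)\}$ of pairs with distinct $b_i$'s, distinct $a_i$'s, no $a_i$ equal to any $b_j$, and $a_i<b_i$; $\mathfrak p_{\mathcal I}=\{b_i\}$, $\mathfrak p_{\mathcal J}=\{a_i\}$. $L\in\mathfrak X_{\mathfrak t}$ is a pattern matrix if each row and column has at most one nonzero entry besides the last 1's; its pattern is $\mathfrak p(L)=\{(i,j)\in\mathfrak J_{\mathfrak t}:l_{ij}\neq0\}$. Each orbit $\mathcal O$ contains exactly one $e_{L_0}$ with $L_0$ a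 pattern matrix, and $\mathfrak p(\mathcal O):=\mathfrak p(L_0)$. $\mathfrak t\setminus(\mathfrak p_{\mathcal I}\cup\mathfrak p_{\mathcal J})$ is obtained from $\mathfrak t$ by deleting the numbers in $\mathfrak p_{\mathcal I}\cup\mathfrak p_{\mathcal J}$ and closing the gaps in each row; it is a row-standard tableau of shape $(n-m-|\mathfrak p|,m-|\mathfrak p|)$ and is called standard if its columns increase. Paths. Consider an array of boxes with $m$ rows and $n-m$ columns; its corners have coordinates $(i,j)$, $1\le i\le m+1$, $1\le j\le n-m+1$, with $(1,1)$ the northwest corner, $i$ increasing to the south and $j$ to the east. The path $\pi_{\mathfrak t}$ runs from $(1,1)$ to $(m+1,n-m+1)$ along the grid: its $k$-th step ($k=1,\dots,n$) goes east if $k$ is in the first row of $\mathfrak t$ and south if $k$ is in the second row. The box in row $i$ and column $j$ lies below (south of) the path iff $a_j<b_i$, i.e. $(b_i,a_j)\in\mathfrak J_{\mathfrak t}$, and $L\in\mathfrak X_{\mathfrak t}$ is regarded as the filling of the boxes below the path putting $l_{b_ia_j}$ in that box. The filling is good if, for each corner $(i,j)$ through which the path passes, the submatrix whose bottom left corner is $(m+1,1)$ and whose top right corner is $(i,j)$ (rows $i,\dots,m$ and columns $1,\dots,j-1$ of boxes) has rank at most $j-i$. *)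

(* Defs.v *)
From HB Require Import structures.
From mathcomp Require Import all_boot all_order all_algebra.
From mathcomp Require Import boolp classical_sets.

Set Implicit Arguments.
Unset Strict Implicit.
Unset Printing Implicit Defensive.

Import GRing.Theory.
Local Open Scope ring_scope.

(* The letters 1, ..., n are encoded by 'I_n: the letter k is
   the ordinal of value k - 1.  Likewise the columns of an m x n matrix are
   indexed by 'I_n, and its row of index i : 'I_m is the row labelled by the
   i-th entry of the second row of the tableau.                              *)

Record RStd (n m : nat) := MkRStd {
  row1 : (n - m)%N.-tuple 'I_n;
  row2 : m.-tuple 'I_n;
  row1_sorted : sorted (fun x y : 'I_n => (x < y)%N) row1;
  row2_sorted : sorted (fun x y : 'I_n => (x < y)%N) row2;
  rows_perm : perm_eq (row1 ++ row2) (enum 'I_n) }.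

Definition J n m (t : RStd n m) : {set 'I_n * 'I_n} :=
  [set x : 'I_n * 'I_n | [&& (x.2 < x.1)%N, x.1 \in row2 t & x.2 \notin row2 t]]%SET.

(* A tableau with two rows of arbitrary lengths; the pairs in zip are exactly
   its columns of length 2.                                                  *)
Definition standard n (r : seq 'I_n * seq 'I_n) : bool :=
  all (fun c : 'I_n * 'I_n => (c.1 < c.2)%N) (zip r.1 r.2).

Definition delete n m (t : RStd n m) (S : {set 'I_n}) : seq 'I_n * seq 'I_n :=
  ([seq x <- row1 t | x \notin S], [seq x <- row2 t | x \notin S]).

Definition pI n (p : {set 'I_n * 'I_n}) : {set 'I_n} := [set x.1 | x in p]%SET.
Definition pJ n (p : {set 'I_n * 'I_n}) : {set 'I_n} := [set x.2 | x in p]%SET.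

Section Matrices.
Variables (Fq : finFieldType) (m n : nat).
Implicit Types L M N : 'M[Fq]_(m, n).

Definition last_ones L (b : m.-tuple 'I_n) : bool :=
  [&& sorted (fun x y : 'I_n => (x < y)%N) b,
      [forall i, L i (tnth b i) == 1],
      [forall i, forall j : 'I_n, (tnth b i < j)%N ==> (L i j == 0)] &
      [forall i : 'I_m, forall k : 'I_m, (i < k)%N ==> (L k (tnth b i) == 0)]].

Definition in_Xi L : bool := [exists b : m.-tuple 'I_n, last_ones L b].

Definition Xi := {L : 'M[Fq]_(m, n) | in_Xi L}.

(* The positions of the last 1's of a matrix in Xi are unique, and a
   row-standard tableau is determined by its second row, so that the condition
   below says that t is the tableau of L.                                    *)
Definition X (t : RStd n m) : {set Xi} :=
  [set L | last_ones (val L) (row2 t)]%SET.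

Definition row_equiv M N : bool :=
  [exists P : 'M[Fq]_m, (P \in unitmx) && (N == P *m M)].

(* For g in unitmx there is exactly one N as below; the default is irrelevant. *)
Definition circ (L : Xi) (g : 'M[Fq]_n) : Xi :=
  odflt L [pick N : Xi | row_equiv (val L *m g) (val N)].

Definition U : {set 'M[Fq]_n} :=
  [set g : 'M[Fq]_n | [forall i, g i i == 1] &&
           [forall i : 'I_n, forall j : 'I_n, (i < j)%N ==> (g i j == 0)]]%SET.

Definition UwU (t : RStd n m) : {set 'M[Fq]_n} :=
  [set g : 'M[Fq]_n in U | [forall i, forall j,
     ((i \notin row2 t) && (j \in row2 t)) ==> (g i j == 0)]]%SET.

Definition pattern_matrix (t : RStd n m) L : bool :=
  [forall i, (#|[set j | (j != tnth (row2 t) i) && (L i j != 0)%R]%SET| <= 1)%N]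
  && [forall j,
       (#|[set i | (j != tnth (row2 t) i) && (L i j != 0)%R]%SET| <= 1)%N].

Definition pattern (t : RStd n m) L : {set 'I_n * 'I_n} :=
  [set x in J t | [exists i : 'I_m, (tnth (row2 t) i == x.1) && (L i x.2 != 0)]]%SET.

End Matrices.

Section Paths.
Variables (Fq : finFieldType) (m n : nat) (t : RStd n m).

(* Corners carry their usual 1-based coordinates (row, column). *)
Definition step (c : nat * nat) (k : 'I_n) : nat * nat :=
  if k \in row1 t then (c.1, c.2.+1) else (c.1.+1, c.2).

Definition path_corners : seq (nat * nat) :=
  (1, 1)%N :: scanl step (1, 1)%N (enum 'I_n).

(* The entries above the path, which are 0, are never used by the submatrices
   attached to the corners of the path.                                      *)
Definition filling (L : 'M[Fq]_(m, n)) : 'M[Fq]_(m, n - m) :=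
  \matrix_(r, c) L r (tnth (row1 t) c).

(* Rows i, ..., m and columns 1, ..., j - 1 of boxes, for the corner (i, j);
   the box of index (r, c) : 'I_m * 'I_(n - m) is in row r + 1, column c + 1.  *)
Definition corner_rows (c : nat * nat) : {set 'I_m} :=
  [set r : 'I_m | (c.1 <= r.+1)%N]%SET.
Definition corner_cols (c : nat * nat) : {set 'I_(n - m)} :=
  [set k : 'I_(n - m) | (k.+1 < c.2)%N]%SET.

Definition corner_mx (L : 'M[Fq]_(m, n)) (c : nat * nat) :
    'M[Fq]_(#|corner_rows c|, #|corner_cols c|) :=
  mxsub (fun r : 'I_#|corner_rows c| => enum_val r)
        (fun k : 'I_#|corner_cols c| => enum_val k) (filling L).

(* The bound is an inequality of integers: j - i may be negative. *)
Definition good (L : 'M[Fq]_(m, n)) : Prop :=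
  forall c : nat * nat, c \in path_corners ->
    ((\rank (corner_mx L c))%:Z <= c.2%:Z - c.1%:Z)%R.

End Paths.

Section PermutationModule.
Variables (Fq : finFieldType) (F : fieldType) (m n : nat).

Definition Mlam := {ffun Xi Fq m n -> F^o}.

Definition basis_vec (L : Xi Fq m n) : Mlam := [ffun N => (N == L)%:R].

Definition act (v : Mlam) (g : 'M[Fq]_n) : Mlam :=
  \sum_(L : Xi Fq m n) v L *: basis_vec (circ L g).

Variables (theta : Fq -> F) (t : RStd n m).

Definition e (L : Xi Fq m n) : Mlam :=
  (#|Fq|%:R ^- #|J t|) *:
  \sum_(M in X Fq t)
    (\prod_(i < m) \prod_(j < n | (tnth (row2 t) i, j) \in J t)
        theta (- (val L i j * val M i j))) *: basis_vec M.

Definition E : set Mlam := [set e L | L in [set L | L \in X Fq t]]%classic.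

Definition is_orbit (O : set Mlam) : Prop :=
  exists2 v, E v &
    O = [set u | E u /\ exists (g : 'M[Fq]_n) (c : F),
                   [/\ g \in UwU Fq t, c != 0 & act v g = c *: u]]%classic.

(* Every orbit contains exactly one e L0 with L0 a pattern matrix. *)
Definition orbit_pattern (O : set Mlam) : {set 'I_n * 'I_n} :=
  xget finset.set0
    [set pattern t (val L0) | L0 in
       [set L0 : Xi Fq m n |
          [/\ L0 \in X Fq t, pattern_matrix t (val L0) & O (e L0)]]]%classic.

End PermutationModule.

Definition nontrivial_character (Fq : finFieldType) (F : fieldType)
    (theta : Fq -> F) : Prop :=
  [/\ forall x, theta x != 0,
      {morph theta : x y / x + y >-> x * y} & exists x, theta x != 1].

(* Main.v *)
From mathcomp Require Import all_boot all_order all_algebra abelian.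
From mathcomp Require Import boolp classical_sets.
From mathcomp Require Import zify.
Require Import Defs.

(** Write b_1 < ... < b_m for the second row of t, with letters from 1 to n.  A matrix L in X_t is
    determined by its entries in J_t, and those positions form the boxes below
    the path, a region closed under moving south or west.

    Action.  For g in U^w :&: U let h be the submatrix of g on the second-row
    letters.  Then L o g = h^-1 L g, because the columns of L g at the
    second-row letters form h, and echelon matrices that are row equivalent
    coincide ([row_equiv_last_ones]).  Substituting M = h N g^-1 in the
    character sum that defines e_L gives e_L g = c e_L' where L' agrees on J_t
    with h^T L g^-T, the last 1's of L being replaced by 0 ([act_e]).  Both h^T and g^-T are upper unitriangular, so L
    changes by adding lower rows to upper rows and left columns to right ones.
    The vectors e_L are pairwise non-proportional ([e_proportional]), so that an
    orbit of lines is the same thing as an orbit of matrices L.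

    Invariants.  A corner of the path is reached after k letters, and its
    submatrix has the rows with b_i > k and the first-row columns a <= k.  Such a
    south-west rectangle lies inside J_t and is only multiplied by invertible
    triangular matrices on both sides, so its rank is constant on the orbit
    ([rank_rect_orbit]).  For the pattern matrix L0 of the orbit this rank is
    the number of pairs (b, a) of the pattern p with a <= k < b
    ([rank_rect_pattern]).  Such an L0 exists by Bruhat elimination: any
    matrix becomes monomial under upper unitriangular row and column operations
    ([bruhat], [exists_pattern_rep]).

    Counting.  Let A_k and B_k be the numbers of letters <= k in the two rows.
    The corner is (B_k + 1, A_k + 1), so L is good iff for every k the number of
    (b, a) in p with a <= k < b is at most A_k - B_k ([goodP]).  Deleting the
    letters of p lowers A_k by the number of pairs with a <= k, and B_k by the
    number of pairs with b <= k; since a < b, the difference A_k - B_k drops by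
    exactly the number of pairs with a <= k < b.  So L is good iff the
    differences of the deleted tableau are all nonnegative, and that ballot
    condition is standardness ([standard_below], [standard_delete]). *)

Set Implicit Arguments.
Unset Strict Implicit.
Unset Printing Implicit Defensive.

Import GRing.Theory.
Local Open Scope ring_scope.

(** * Coordinate projections and ranks of submatrices *)

Section CoordinateProjections.
Variable R : fieldType.

Definition proj k (S : {set 'I_k}) : 'M[R]_k := diag_mx (\row_i (i \in S)%:R).

Lemma proj_mulE k l (S : {set 'I_k}) (A : 'M_(k, l)) i j :
  (proj S *m A) i j = (i \in S)%:R * A i j.
Proof. by rewrite mul_diag_mx !mxE. Qed.

Lemma mul_projE k l (S : {set 'I_l}) (A : 'M_(k, l)) i j :
  (A *m proj S) i j = A i j * (j \in S)%:R.
Proof. by rewrite mul_mx_diag !mxE. Qed.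

Lemma tr_proj k (S : {set 'I_k}) : (proj S)^T = proj S.
Proof. exact: tr_diag_mx. Qed.

Lemma proj_idem k (S : {set 'I_k}) : proj S *m proj S = proj S.
Proof.
apply/matrixP => i j; rewrite proj_mulE !mxE.
by case: (i \in S); rewrite ?mul1r ?mul0r ?mul0rn.
Qed.

Lemma proj_mul_absorb k l (S : {set 'I_k}) (T : {set 'I_l}) (A : 'M_(k, l)) :
  (forall i j, i \in S -> j \notin T -> A i j = 0) ->
  proj S *m A = proj S *m A *m proj T.
Proof.
move=> A0; apply/matrixP => i j; rewrite mul_projE proj_mulE.
have [iS|_] := boolP (i \in S); last by rewrite !mul0r.
have [_|jT] := boolP (j \in T); first by rewrite mulr1.
by rewrite A0 // !mulr0.
Qed.

Lemma mul_proj_absorb k l (S : {set 'I_k}) (T : {set 'I_l}) (A : 'M_(k, l)) :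
  (forall i j, i \notin S -> j \in T -> A i j = 0) ->
  A *m proj T = proj S *m A *m proj T.
Proof.
move=> A0; apply: trmx_inj; rewrite !trmx_mul !tr_proj mulmxA.
by apply: proj_mul_absorb => i j iT jS; rewrite mxE A0.
Qed.

(** The hypotheses say that [A] and [A'] are block triangular with respect to
    [D], and [B] and [B'] with respect to [C]; the corner cut out by [D] and [C]
    is then multiplied by the diagonal blocks alone, and these are invertible. *)
Lemma rank_stable k l (A A' D : 'M[R]_k) (B B' C : 'M[R]_l) (Y : 'M_(k, l)) :
  A' *m A = 1%:M -> B *m B' = 1%:M ->
  D *m A = D *m A *m D -> D *m A' = D *m A' *m D -> D *m D = D ->
  B *m C = C *m B *m C -> B' *m C = C *m B' *m C -> C *m C = C ->
  \rank (D *m (A *m Y *m B) *m C) = \rank (D *m Y *m C).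
Proof.
move=> A'A BB' DA DA' DD BC B'C CC.
have E1 : D *m (A *m Y *m B) *m C = D *m A *m (D *m Y *m C) *m (B *m C).
  by rewrite !mulmxA -DA -!mulmxA (mulmxA C) -BC.
apply/eqP; rewrite eqn_leq; apply/andP; split.
  by rewrite E1; apply: leq_trans (mxrankM_maxl _ _) (mxrankM_maxr _ _).
have E2 : D *m Y *m C = D *m A' *m (D *m (A *m Y *m B) *m C) *m (B' *m C).
  rewrite !mulmxA -DA' -(mulmxA D A' A) A'A mulmx1.
  by rewrite -!mulmxA (mulmxA C B') -B'C (mulmxA B) BB' mul1mx.
by rewrite E2; apply: leq_trans (mxrankM_maxl _ _) (mxrankM_maxr _ _).
Qed.

(** A submatrix is a two-sided product with 0/1 selection matrices.  These are
    partial isometries, which is how ranks of submatrices compare with ranks of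
    projected matrices of full size. *)
Lemma mxsub_pinching k l k' l' (f : 'I_k' -> 'I_k) (g : 'I_l' -> 'I_l)
    (A : 'M[R]_(k, l)) :
  mxsub f g A = rowsub f 1%:M *m A *m (rowsub g 1%:M)^T.
Proof.
rewrite trmx_mxsub trmx1 mulmx_colsub mulmx1 mul_rowsub_mx mul1mx.
by apply/matrixP => i j; rewrite !mxE.
Qed.

Lemma rowsub1_mul_tr k k' (f : 'I_k' -> 'I_k) : injective f ->
  rowsub f 1%:M *m (rowsub f 1%:M)^T = 1%:M :> 'M[R]_k'.
Proof.
move=> f_inj; apply/matrixP => i j.
by rewrite mul_rowsub_mx mul1mx !mxE (inj_eq f_inj) eq_sym.
Qed.

Lemma tr_rowsub1_mul k k' (f : 'I_k' -> 'I_k) : injective f ->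
  (rowsub f 1%:M)^T *m rowsub f 1%:M = proj [set f i | i : 'I_k']%SET.
Proof.
move=> f_inj; apply/matrixP => i j; rewrite !mxE.
under eq_bigr do rewrite !mxE.
have [/imsetP[a _ ->]|iN] := boolP (i \in _)%SET.
  rewrite (bigD1 a) //= eqxx mul1r big1 ?addr0 // => b ba.
  by rewrite (inj_eq f_inj) (negPf ba) mul0r.
rewrite mul0rn big1 // => a _; case: eqP => [ia|]; last by rewrite mul0r.
by case/imsetP: iN; exists a.
Qed.

Lemma rank_mxsub k l k' l' (f : 'I_k' -> 'I_k) (g : 'I_l' -> 'I_l)
    (A : 'M[R]_(k, l)) : injective f -> injective g ->
  \rank (mxsub f g A) =
  \rank (proj [set f i | i : 'I_k']%SET *m A *m proj [set g i | i : 'I_l']%SET).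
Proof.
move=> f_inj g_inj; rewrite mxsub_pinching -!tr_rowsub1_mul //.
set P := rowsub f _; set Q := rowsub g _.
apply/eqP; rewrite eqn_leq; apply/andP; split; last first.
  have -> : P^T *m P *m A *m (Q^T *m Q) = P^T *m (P *m A *m Q^T) *m Q.
    by rewrite !mulmxA.
  by apply: leq_trans (mxrankM_maxl _ _) (mxrankM_maxr _ _).
have -> : P *m A *m Q^T = P *m (P^T *m P *m A *m (Q^T *m Q)) *m Q^T.
  rewrite !mulmxA rowsub1_mul_tr // mul1mx -!mulmxA rowsub1_mul_tr //.
  by rewrite mulmx1.
by apply: leq_trans (mxrankM_maxl _ _) (mxrankM_maxr _ _).
Qed.

Lemma rank_proj k (S : {set 'I_k}) : \rank (proj S) = #|S|.
Proof.
pose f (i : 'I_#|S|) := enum_val i.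
have f_inj : injective f by apply: enum_val_inj.
have := rank_mxsub 1%:M f_inj f_inj.
have -> : mxsub f f 1%:M = 1%:M :> 'M[R]_#|S|.
  by apply/matrixP => i j; rewrite !mxE (inj_eq f_inj).
have -> : [set f i | i : 'I_#|S|]%SET = S.
  apply/setP => x; apply/imsetP/idP => [[i _ ->]|xS]; first exact: enum_valP.
  by exists (enum_rank_in xS x); rewrite // /f enum_rankK_in.
by rewrite mulmx1 proj_idem mxrank1.
Qed.

Definition monomial k l (A : 'M[R]_(k, l)) :=
  (forall i j j', A i j != 0 -> A i j' != 0 -> j = j') /\
  (forall i i' j, A i j != 0 -> A i' j != 0 -> i = i').

(** The product of a monomial matrix with the transpose of its entrywise inverse
    is the projection onto its nonzero rows. *)
Lemma rank_monomial k l (A : 'M[R]_(k, l)) : monomial A ->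
  \rank A = #|[set i | [exists j, A i j != 0]]%SET|.
Proof.
move=> [row_inj col_inj]; set S := [set i | _]%SET; rewrite -rank_proj.
apply/eqP; rewrite eqn_leq; apply/andP; split.
  have -> : A = proj S *m A; last exact: mxrankM_maxl.
  apply/matrixP => i j; rewrite proj_mulE inE.
  case: existsP => [_|AN]; first by rewrite mul1r.
  by rewrite mul0r; apply: contra_notP AN => /eqP Aij; exists j.
suff -> : proj S = A *m (map_mx (@GRing.inv R) A)^T by exact: mxrankM_maxl.
apply/matrixP => i i'; rewrite !mxE; under eq_bigr do rewrite !mxE.
have [<-|ii'] := eqVneq i i'; last first.
  rewrite mulr0n big1 // => j _; apply/eqP; rewrite mulf_eq0 invr_eq0.
  by apply: contra_neqT ii'; rewrite negb_or => /andP[/col_inj]; apply.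
rewrite mulr1n inE; case: existsP => [[j Aij]|AN].
  rewrite (bigD1 j) //= divff // big1 ?addr0 // => j' j'j.
  apply/eqP; rewrite mulf_eq0 invr_eq0 orbb.
  by apply: contra_neqT j'j => Aij'; apply: row_inj Aij.
rewrite big1 // => j _; apply/eqP; rewrite mulf_eq0.
by apply: contra_notT AN; rewrite negb_or => /andP[? _]; exists j.
Qed.

End CoordinateProjections.

(** * Unitriangular matrices and Bruhat elimination *)

Section Unitriangular.
Variable R : fieldType.

Definition unitri k (A : 'M[R]_k) :=
  (forall i, A i i = 1) /\ (forall i j : 'I_k, (i < j)%N -> A i j = 0).

Lemma unitri_unit k (A : 'M[R]_k) : unitri A -> A \in unitmx.
Proof.
move=> [A1 A0]; rewrite unitmxE det_trig; last exact/is_trig_mxP.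
by rewrite big1 // unitr1.
Qed.

Lemma unitri1 k : unitri (1%:M : 'M[R]_k).
Proof.
split=> [i|i j ij]; rewrite mxE ?eqxx //.
by rewrite -(inj_eq val_inj) ltn_eqF.
Qed.

Lemma unitri_mul k (A B : 'M[R]_k) : unitri A -> unitri B -> unitri (A *m B).
Proof.
move=> [A1 A0] [B1 B0]; split=> [i|i j ij]; rewrite !mxE.
  rewrite (bigD1 i) //= A1 B1 mulr1 big1 ?addr0 // => a /eqP ai.
  have [ia|ia] := ltnP i a; first by rewrite A0 ?mul0r.
  by rewrite B0 ?mulr0 //; rewrite ltn_neqAle ia andbT; apply/eqP => /val_inj.
rewrite big1 // => a _; have [ia|ai] := ltnP i a; first by rewrite A0 ?mul0r.
by rewrite B0 ?mulr0 // (leq_ltn_trans ai).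
Qed.

(** Forward substitution: a set [T] of off-diagonal positions where the inverse
    is to vanish propagates upwards along the nonzero entries of [A].  It serves
    both for the triangular shape and for the block shape of an inverse. *)
Lemma unitri_inv_vanish k (A : 'M[R]_k) (T : 'I_k -> 'I_k -> Prop) :
  unitri A -> (forall i j, T i j -> i != j) ->
  (forall i a j : 'I_k, (a < i)%N -> A i a != 0 -> T i j -> T a j) ->
  forall i j, T i j -> invmx A i j = 0.
Proof.
move=> Au; have [A1 A0] := Au => Tne Tstep.
suff H c : forall i j : 'I_k, (i < c)%N -> T i j -> invmx A i j = 0.
  by move=> i j; apply: (H i.+1).
elim: c => // c IH i j ic Tij.
have /matrixP/(_ i j) := mulmxV (unitri_unit Au).
rewrite !mxE (negPf (Tne _ _ Tij)) (bigD1 i) //= A1 mul1r.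
rewrite big1 ?addr0 // => a /eqP ai.
have [->|Aia] := eqVneq (A i a) 0; first by rewrite mul0r.
have ltai : (a < i)%N.
  rewrite ltn_neqAle leqNgt; apply/andP; split; first by apply/eqP => /val_inj.
  by apply: contra_neqN Aia => /A0.
by rewrite IH ?mulr0 ?(leq_trans ltai) //; apply: Tstep Tij.
Qed.

Lemma unitri_inv k (A : 'M[R]_k) : unitri A -> unitri (invmx A).
Proof.
move=> Au; have [A1 A0] := Au.
have V0 (i j : 'I_k) : (i < j)%N -> invmx A i j = 0.
  apply: (@unitri_inv_vanish _ _ (fun i j => (i < j)%N)) => // [{}i {}j ij|].
    by rewrite -(inj_eq val_inj) ltn_eqF.
  by move=> a b c ba _; apply: ltn_trans.
split=> // i; have /matrixP/(_ i i) := mulmxV (unitri_unit Au).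
rewrite !mxE eqxx (bigD1 i) //= A1 mul1r big1 ?addr0 // => a /eqP ai.
have [ia|ia] := ltnP i a; first by rewrite A0 ?mul0r.
by rewrite V0 ?mulr0 //; rewrite ltn_neqAle ia andbT; apply/eqP => /val_inj.
Qed.

(** The state of the elimination after the first [c] columns: each of them has at
    most one nonzero entry, and that entry is alone in its whole row. *)
Definition cleared k l (c : nat) (A : 'M[R]_(k, l)) :=
  forall j : 'I_l, (j < c)%N ->
    (forall i i', A i j != 0 -> A i' j != 0 -> i = i') /\
    (forall i j', A i j != 0 -> A i j' != 0 -> j = j').

(** The pivot is the lowest nonzero entry of column [c], so that only upper rows
    have to be changed; its row vanishes to the left of [c] because the rows of
    the earlier pivots are already empty elsewhere. *)
Lemma clear_column k l (c : 'I_l) (A : 'M[R]_(k, l)) : cleared c A ->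
  exists h w, [/\ unitri h, unitri w & cleared c.+1 (h^T *m A *m w^T)].
Proof.
move=> Ac; have [/existsP[r0 r0P]|/existsPn Ac0] := boolP [exists r, A r c != 0];
    last first.
  exists 1%:M, 1%:M; split; try exact: unitri1.
  rewrite !trmx1 mulmx1 mul1mx => j; rewrite ltnS leq_eqVlt.
  case/orP=> [/eqP/val_inj ->|]; last exact: Ac.
  by split=> i ? /negPf; move: (Ac0 i); rewrite negbK => /eqP->; rewrite eqxx.
case: (@arg_maxnP _ r0 (fun r => A r c != 0) (@nat_of_ord k) r0P) => r rP rmax.
have Ar0 (j : 'I_l) : (j < c)%N -> A r j = 0.
  move=> jc; apply/eqP; apply: contraTT jc => Arj; rewrite -leqNgt.
  have [//|jc] := leqP c j; have [_ /(_ r c Arj rP) E] := Ac j jc.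
  by rewrite E ltnn in jc.
(* Clear column [c] above the pivot with [v], then the row of the pivot with
   [z]; [v] vanishes from [r] on and [z] up to [c], so both are triangular. *)
pose v i := if i == r then 0 else A i c / A r c.
pose z j := if j == c then 0 else A r j / A r c.
pose h : 'M_k := \matrix_(i, j) ((i == j)%:R - (i == r)%:R * v j).
pose w : 'M_l := \matrix_(i, j) ((i == j)%:R - z i * (j == c)%:R).
exists h, w.
have neqlt a (x y : 'I_a) : (x < y)%N -> (x == y) = false.
  by move=> xy; rewrite -(inj_eq val_inj) ltn_eqF.
have E i j : (h^T *m A *m w^T) i j =
     if i == r then (j == c)%:R * A r c else A i j - A i c * A r j / A r c.
  have E1 i' j' : (h^T *m A) i' j' = A i' j' - v i' * A r j'.
    rewrite !mxE; under eq_bigr do rewrite !mxE mulrBl.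
    rewrite sumrB (bigD1 i') //= eqxx mul1r big1 ?addr0 => [|a /negPf->]; last first.
      by rewrite mul0r.
    rewrite (bigD1 r) //= eqxx mul1r big1 ?addr0 // => a /negPf->.
    by rewrite !mul0r.
  rewrite mxE; under eq_bigr do rewrite E1 !mxE mulrBr.
  rewrite sumrB (bigD1 j) //= eqxx mulr1 big1 ?addr0 => [|a]; last first.
    by rewrite eq_sym => /negPf->; rewrite mulr0.
  rewrite (bigD1 c) //= eqxx mulr1 big1 ?addr0 => [|a /negPf->]; last first.
    by rewrite !mulr0.
  rewrite /v /z; case: (eqVneq i r) => [->|ir].
    case: (eqVneq j c) => [->|jc]; first by rewrite !mul0r mulr0 !subr0 mul1r.
    by rewrite !mul0r !subr0 mulrCA divff // mulr1 subrr.
  by rewrite mulfVK // subrr mul0r subr0 mulrAC.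
split.
- split=> [i|i j ij]; rewrite mxE /v ?eqxx.
    by case: (i == r); rewrite ?mul0r ?mulr0 subr0.
  rewrite (neqlt _ _ _ ij); case: (eqVneq i r) => [ir|_]; last by rewrite mul0r subr0.
  rewrite -ir eq_sym (neqlt _ _ _ ij) (_ : A j c = 0) ?mul0r ?mulr0 ?subr0 //.
  apply/eqP; apply: contraTT ij => /rmax jr; rewrite ir -leqNgt.
  exact: jr.
- split=> [i|i j ij]; rewrite mxE /z ?eqxx.
    by case: (i == c); rewrite ?mul0r ?mulr0 subr0.
  rewrite (neqlt _ _ _ ij); case: (eqVneq j c) => [jc|_]; last by rewrite mulr0 subr0.
  by rewrite jc in ij; rewrite neqlt // Ar0 // !mul0r subr0.
set N := (_ *m _ *m _) in E *.
have Nlt i (j : 'I_l) : (j < c)%N -> N i j = A i j.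
  move=> jc; rewrite E (Ar0 j jc) mulr0 mul0r subr0 (neqlt _ _ _ jc) mul0r.
  by case: eqP => // ->; rewrite Ar0.
move=> j; rewrite ltnS leq_eqVlt => /orP[/eqP/val_inj ->|jc].
  have Nc i : N i c != 0 -> i = r.
    by rewrite E; case: (eqVneq i r) => // _; rewrite mulfK // subrr eqxx.
  split=> [i i' /Nc-> /Nc->//|i j' /Nc->].
  rewrite E eqxx; case: (eqVneq j' c) => [->//|_].
  by rewrite mul0r eqxx.
have [Ac1 Ac2] := Ac j jc; split=> [i i'|i j']; rewrite ?(Nlt _ j) //.
  exact: Ac1.
move=> Aij; have ir : i != r by apply: contra_neq Aij => ->; apply: Ar0.
have Aic : A i c = 0.
  apply/eqP; apply: contraTT jc => Aic; rewrite -leqNgt.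
  by rewrite (Ac2 i c).
by rewrite E (negPf ir) Aic !mul0r subr0; apply: Ac2.
Qed.

(** The weak form of the Bruhat decomposition, for rectangular matrices of any
    rank. *)
Lemma bruhat k l (A : 'M[R]_(k, l)) :
  exists h w, [/\ unitri h, unitri w & monomial (h^T *m A *m w^T)].
Proof.
suff H c : (c <= l)%N ->
    exists h w, [/\ unitri h, unitri w & cleared c (h^T *m A *m w^T)].
  have [h [w [hu wu Ac]]] := H l (leqnn l); exists h, w; split=> //.
  split=> [i j j'|i i' j]; have [C1 C2] := Ac j (ltn_ord j).
    exact: C2.
  exact: C1.
elim: c => [_|c IH cl]; first by exists 1%:M, 1%:M; split=> //; exact: unitri1.
have [h [w [hu wu /(@clear_column _ _ (Ordinal cl))]]] := IH (ltnW cl).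
move=> [h' [w' [h'u w'u Ac]]]; exists (h *m h'), (w' *m w).
split; [exact: unitri_mul|exact: unitri_mul|].
rewrite !trmx_mul; rewrite !mulmxA in Ac *; exact: Ac.
Qed.

End Unitriangular.

(** * Two-row tableaux, their paths, and standardness *)

Section Tableaux.
Variable n : nat.
Implicit Types (s : seq 'I_n) (k : nat).

Definition below k s := count (fun x : 'I_n => (x < k)%N) s.
Arguments below : simpl never.

Lemma ltn_ord_trans : transitive (fun x y : 'I_n => (x < y)%N).
Proof. by move=> x y z; apply: ltn_trans. Qed.

Lemma sorted_ltn_ord_uniq s : sorted (fun x y : 'I_n => (x < y)%N) s -> uniq s.
Proof. by apply: (sorted_uniq ltn_ord_trans) => x; apply: ltnn. Qed.

(** Galois connection between the entries of an increasing row and its counting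
    function; it turns comparisons of columns into comparisons of counts. *)
Lemma nth_ltn_below x0 s k i : sorted (fun x y : 'I_n => (x < y)%N) s ->
  (i < size s)%N -> (nth x0 s i < k)%N = (i < below k s)%N.
Proof.
elim: s i => // x s IH i /= xs.
have := order_path_min ltn_ord_trans xs; move: xs => /path_sorted/IH {}IH /allP xs.
have [xk|kx] := ltnP x k.
  have -> : below k (x :: s) = (below k s).+1 by rewrite /below /= xk.
  by case: i => [|i] //= si; apply: IH.
have -> : below k (x :: s) = 0%N.
  apply/eqP; rewrite -leqn0 leqNgt -has_count; apply/hasPn => y.
  by rewrite inE -leqNgt => /predU1P[->//|/xs/ltnW]; apply: leq_trans.
case: i => [|i] /= si; first by rewrite ltnNge kx.
by apply/negbTE; rewrite -leqNgt (leq_trans kx) // ltnW // xs // mem_nth.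
Qed.

Lemma tnth_sorted_ltn m (b : m.-tuple 'I_n) (i j : 'I_m) :
  sorted (fun x y : 'I_n => (x < y)%N) b ->
  (tnth b i < tnth b j)%N = (i < j)%N.
Proof.
move=> sb; have H (c d : 'I_m) : (c < d)%N -> (tnth b c < tnth b d)%N.
  move=> cd; have x0 := tnth b c; rewrite !(tnth_nth x0).
  by apply: (sorted_ltn_nth ltn_ord_trans _ sb) => //; rewrite inE size_tuple.
have [/H//|ji] := ltnP i j; apply/negbTE; rewrite -leqNgt.
by move: ji; rewrite leq_eqVlt => /predU1P[/val_inj->//|/H/ltnW].
Qed.

Lemma below_size s : below n s = size s.
Proof. by apply/eqP; rewrite -all_count; apply/allP => x _. Qed.

(** Standardness as a ballot condition: every initial segment of the alphabet
    has at least as many letters in the first row as in the second. *)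
Lemma standard_below (r s : seq 'I_n) :
  sorted (fun x y : 'I_n => (x < y)%N) r ->
  sorted (fun x y : 'I_n => (x < y)%N) s ->
  (size s <= size r)%N -> {in s, forall x, x \notin r} ->
  standard (r, s) <-> forall k, (k <= n)%N -> (below k s <= below k r)%N.
Proof.
move=> rs ss sr dis; case: (posnP (size s)) => [/size0nil->|s0].
  by split=> // _; rewrite /standard /=; case: r {rs sr dis}.
have x0 : 'I_n by case: s s0 {ss sr dis}.
have E i : (i < size s)%N -> nth (x0, x0) (zip r s) i = (nth x0 r i, nth x0 s i).
  by move=> si; rewrite nth_zip_cond size_zip (minn_idPr sr) si.
have zs : size (zip r s) = size s by rewrite size_zip (minn_idPr sr).
split=> [/(all_nthP (x0, x0))/= H k _|H].
  rewrite leqNgt; apply/negP => lt.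
  have lts : (below k r < size s)%N by apply: leq_trans lt (count_size _ _).
  have := lt; rewrite -(nth_ltn_below x0 k ss lts).
  have := H (below k r); rewrite zs E //= => /(_ lts) /ltn_trans h /h.
  by rewrite nth_ltn_below ?ltnn // (leq_trans lts).
apply/(all_nthP (x0, x0)) => i; rewrite zs => si; rewrite E //=.
have ri := leq_trans si sr.
have : (nth x0 r i < (nth x0 s i).+1)%N.
  rewrite nth_ltn_below // (leq_trans _ (H _ (ltn_ord _))) //.
  by rewrite -(nth_ltn_below x0).
rewrite ltnS leq_eqVlt => /predU1P[/val_inj e|//].
by have := dis _ (mem_nth x0 si); rewrite -e mem_nth.
Qed.

Lemma below_filter_out (Q : {set 'I_n}) s k : uniq s -> {subset Q <= s} ->
  (below k [seq x <- s | x \notin Q] + #|[set x in Q | (x < k)%N]%SET|)%N = below k s.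
Proof.
move=> us Qs.
have -> : #|[set x in Q | (x < k)%N]%SET| = below k [seq x <- s | x \in Q].
  rewrite /below -size_filter -(card_uniqP _) ?filter_uniq //.
  apply: eq_card => x; rewrite !inE !mem_filter.
  by have [/Qs->|] := boolP (x \in Q); rewrite ?andbT // andbF.
by rewrite addnC /below -count_cat; apply/permP; rewrite perm_filterC.
Qed.

Variables (m : nat) (t : RStd n m).

Lemma row1_uniq : uniq (row1 t).
Proof. exact: sorted_ltn_ord_uniq (row1_sorted t). Qed.

Lemma row2_uniq : uniq (row2 t).
Proof. exact: sorted_ltn_ord_uniq (row2_sorted t). Qed.

Lemma mem_row1 x : (x \in row1 t) = (x \notin row2 t).
Proof.
have := perm_uniq (rows_perm t); rewrite enum_uniq cat_uniq => /and3P[_ /hasPn H _].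
have := perm_mem (rows_perm t) x; rewrite mem_enum mem_cat inE.
have [/H/= /negbTE->//|_] := boolP (x \in row2 t).
by rewrite orbF.
Qed.

Lemma tnth_row2_ltn (i j : 'I_m) :
  (tnth (row2 t) i < tnth (row2 t) j)%N = (i < j)%N.
Proof. exact: tnth_sorted_ltn (row2_sorted t). Qed.

Lemma tnth_row2_inj : injective (tnth (row2 t)).
Proof. by apply/tuple_uniqP; apply: row2_uniq. Qed.

Lemma tnth_row2_eq i j : (tnth (row2 t) i == tnth (row2 t) j) = (i == j).
Proof. exact: inj_eq tnth_row2_inj _ _. Qed.

Lemma row2P x : reflect (exists i, x = tnth (row2 t) i) (x \in row2 t).
Proof. exact: tnthP. Qed.

Lemma below_take_enum (P : pred 'I_n) s k : uniq s -> s =i P -> 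
  count P (take k (enum 'I_n)) = below k s.
Proof.
move=> us sP; rewrite /below -!size_filter; apply: perm_size.
apply: uniq_perm; rewrite ?filter_uniq ?take_uniq ?enum_uniq // => x.
rewrite !mem_filter in_take ?mem_enum // index_enum_ord sP andbC.
by rewrite unfold_in.
Qed.

(** The corner reached after [k] steps counts the letters of each row among the
    first [k]. *)
Lemma path_cornersP c : reflect
  (exists2 k, (k <= n)%N & c = ((below k (row2 t)).+1, (below k (row1 t)).+1))
  (c \in path_corners t).
Proof.
have F s c0 : foldl (step t) c0 s =
    ((c0.1 + count [predC row1 t] s)%N, (c0.2 + count (mem (row1 t)) s)%N).
  elim: s c0 => [|x s IH] [a b] /=; first by rewrite !addn0.
  rewrite /step; case: (x \in row1 t); rewrite IH /= ?add0n ?add1n //.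
    by rewrite addSnnS.
  by rewrite addSnnS.
have N k : (k <= n)%N -> nth (1, 1)%N (path_corners t) k =
    ((below k (row2 t)).+1, (below k (row1 t)).+1).
  move=> kn; rewrite nth_cons_scanl ?size_enum_ord // F !add1n.
  rewrite (@below_take_enum (mem (row1 t)) (row1 t) k row1_uniq) //.
  rewrite (@below_take_enum [predC row1 t] (row2 t) k row2_uniq) // => x.
  by rewrite inE /= mem_row1 negbK.
have S : size (path_corners t) = n.+1 by rewrite /= size_scanl size_enum_ord.
apply: (iffP (nthP (1, 1)%N)) => [[k]|[k kn ->]]; rewrite S.
  by rewrite ltnS => kn <-; exists k; rewrite ?N.
by exists k; rewrite ?S ?N.
Qed.

(** Each pair (b, a) of [p] is removed from both counts once [k] has passed b,
    and from the count of the first row alone while a < k <= b. *)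
Lemma standard_delete (p : {set 'I_n * 'I_n}) : (m.*2 <= n)%N -> p \subset J t ->
  {in p &, injective fst} -> {in p &, injective snd} ->
  standard (delete t (pI p :|: pJ p)%SET) <->
  forall k, (k <= n)%N ->
    (#|[set x in p | (x.2 < k <= x.1)%N]%SET| + below k (row2 t) <=
     below k (row1 t))%N.
Proof.
move=> mn /fintype.subsetP pJt inj1 inj2.
have I2 : {subset pI p <= row2 t}.
  by move=> _ /imsetP[x /pJt + ->]; rewrite inE => /and3P[].
have J1 : {subset pJ p <= row1 t}.
  by move=> _ /imsetP[x /pJt + ->]; rewrite mem_row1 inE => /and3P[].
have E1 : [seq x <- row1 t | x \notin (pI p :|: pJ p)%SET] =
          [seq x <- row1 t | x \notin pJ p].
  apply: eq_in_filter => x x1; rewrite inE.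
  by have [/I2|//] := boolP (x \in pI p); rewrite mem_row1 in x1; rewrite (negPf x1).
have E2 : [seq x <- row2 t | x \notin (pI p :|: pJ p)%SET] =
          [seq x <- row2 t | x \notin pI p].
  apply: eq_in_filter => x x2; rewrite inE.
  by have [/J1|//] := boolP (x \in pJ p); rewrite ?orbF // mem_row1 x2.
have C1 k := below_filter_out k row1_uniq J1.
have C2 k := below_filter_out k row2_uniq I2.
have D1 k : #|[set x in pJ p | (x < k)%N]%SET| = #|[set x in p | (x.2 < k)%N]%SET|.
  rewrite -(@card_in_imset _ _ snd) => [|x y]; last first.
    by rewrite !inE => /andP[xp _] /andP[yp _]; apply: inj2.
  apply: eq_card => x; apply/setIdP/imsetP => [[/imsetP[y yp ->] yk]|[y]].
    by exists y => //; rewrite inE yp.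
  by rewrite inE => /andP[yp yk] ->; split=> //; apply/imsetP; exists y.
have D2 k : #|[set x in pI p | (x < k)%N]%SET| = #|[set x in p | (x.1 < k)%N]%SET|.
  rewrite -(@card_in_imset _ _ fst) => [|x y]; last first.
    by rewrite !inE => /andP[xp _] /andP[yp _]; apply: inj1.
  apply: eq_card => x; apply/setIdP/imsetP => [[/imsetP[y yp ->] yk]|[y]].
    by exists y => //; rewrite inE yp.
  by rewrite inE => /andP[yp yk] ->; split=> //; apply/imsetP; exists y.
have D k : #|[set x in p | (x.2 < k)%N]%SET| =
    (#|[set x in p | (x.1 < k)%N]%SET| + #|[set x in p | (x.2 < k <= x.1)%N]%SET|)%N.
  rewrite -(cardsID [set x : 'I_n * 'I_n | (x.1 < k)%N]%SET).
  congr (_ + _)%N; apply: eq_card => x.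
    rewrite !inE; have [/pJt|//] := boolP (x \in p).
    rewrite inE => /andP[lt _]; case: (ltnP x.1 k) => //; rewrite ?andbF //.
    by rewrite andbT => /(ltn_trans lt)->.
  by rewrite !inE -leqNgt andbC -andbA.
rewrite /delete E1 E2; have S1 := C1 n; have S2 := C2 n.
rewrite D1 D below_size in S1; rewrite D2 below_size in S2.
rewrite !below_size !size_tuple in S1 S2.
(* At [k = n] no pair is open, so both rows lose the same number of letters and
   the first stays at least as long as the second. *)
have D0 : [set x in p | (x.2 < n <= x.1)%N]%SET = finset.set0.
  by apply/setP => x; rewrite !inE [(n <= _)%N]leqNgt !ltn_ord !andbF.
rewrite D0 cards0 in S1.
apply: (iff_trans (standard_below _ _ _ _)).
- exact: (sorted_filter ltn_ord_trans) (row1_sorted t).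
- exact: (sorted_filter ltn_ord_trans) (row2_sorted t).
- by lia.
- move=> x; rewrite mem_filter => /andP[_ x2].
  by rewrite mem_filter mem_row1 x2 andbF.
by split=> H k /H; have := C1 k; have := C2 k; rewrite D1 D2 D; lia.
Qed.

End Tableaux.

(** * Echelon matrices and the action of the group *)

Section EchelonForms.
Variables (Fq : finFieldType) (m n : nat).
Implicit Types (M N : 'M[Fq]_(m, n)) (b c : m.-tuple 'I_n).

Lemma last_onesP M b : reflect
  [/\ sorted (fun x y : 'I_n => (x < y)%N) b,
      forall i k, M i (tnth b k) = (i == k)%:R &
      forall i (j : 'I_n), (tnth b i < j)%N -> M i j = 0]
  (last_ones M b).
Proof.
apply: (iffP and4P) => [[sb /forallP M1 /forallP M0 /forallP Mc]|[sb Mb M0]].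
  have {}M0 i (j : 'I_n) : (tnth b i < j)%N -> M i j = 0.
    by move=> ij; have /forallP/(_ j) := M0 i; rewrite ij => /eqP.
  split=> // i k; case: (ltngtP i k) => [ik|ki|/val_inj->].
  - by rewrite M0 ?tnth_sorted_ltn // -(inj_eq val_inj) ltn_eqF.
  - have /forallP/(_ i) := Mc k; rewrite ki => /eqP->.
    by rewrite -(inj_eq val_inj) gtn_eqF.
  by rewrite eqxx (eqP (M1 k)).
split=> //; apply/forallP => i; first by rewrite Mb eqxx.
  by apply/forallP => j; apply/implyP => /M0->.
apply/forallP => k; apply/implyP => ik; rewrite Mb.
by rewrite -(inj_eq val_inj) gtn_eqF.
Qed.

(** The last row that occurs in the combination decides: its last 1 is alone in
    its column, and the rows above it have already ended. *)
Lemma last_position M b (x : 'rV_m) : last_ones M b -> x != 0 ->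
  exists i, (x *m M) 0 (tnth b i) != 0 /\
    forall j : 'I_n, (tnth b i < j)%N -> (x *m M) 0 j = 0.
Proof.
move=> /last_onesP[sb Mb M0] x0.
have [i0 i0P] : exists i, x 0 i != 0.
  apply/existsP; apply: contra_neqT x0; rewrite negb_exists => /forallP x0.
  by apply/rowP => i; rewrite mxE; apply/eqP; have := x0 i; rewrite negbK.
case: (@arg_maxnP _ i0 (fun r => x 0 r != 0) (@nat_of_ord m) i0P) => i xi imax.
exists i; split=> [|j ij]; rewrite mxE.
  rewrite (bigD1 i) //= Mb eqxx mulr1 big1 ?addr0 // => k ki.
  by rewrite Mb (negPf ki) mulr0.
apply: big1 => k _; have [->|/imax] := eqVneq (x 0 k) 0; first by rewrite mul0r.
move=> /= ki; rewrite M0 ?mulr0 // (leq_ltn_trans _ ij) //.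
by rewrite leqNgt tnth_sorted_ltn // -leqNgt.
Qed.

Lemma last_ones_sub M N b c (P : 'M_m) : last_ones M b -> last_ones N c ->
  N = P *m M -> {subset c <= b}.
Proof.
move=> Mb Nc NP _ /tnthP[i ->].
have [_ N1 N0] := last_onesP _ _ Nc.
have E j : N i j = (row i P *m M) 0 j by rewrite -row_mul -NP mxE.
have [|k [Mk0 Mk]] := @last_position M b (row i P) Mb.
  apply/eqP => P0; have := N1 i i; rewrite E P0 mul0mx mxE eqxx.
  by move/eqP; rewrite eq_sym oner_eq0.
suff -> : tnth c i = tnth b k by apply: mem_tnth.
case: (ltngtP (tnth c i) (tnth b k)) => [/N0|/Mk|/val_inj//]; rewrite -?E.
  by rewrite E => /eqP; rewrite (negPf Mk0).
by rewrite N1 eqxx => /eqP; rewrite oner_eq0.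
Qed.

(** Uniqueness of the reduced echelon form: the last ones are determined by the
    row space, and then the columns at the last ones force [P] to be 1. *)
Lemma row_equiv_last_ones M N b c (P : 'M_m) : last_ones M b -> last_ones N c ->
  P \in unitmx -> N = P *m M -> N = M.
Proof.
move=> Mb Nc Pu NP; have MP : M = invmx P *m N by rewrite NP mulKmx.
have [sb M1 _] := last_onesP _ _ Mb; have [sc N1 _] := last_onesP _ _ Nc.
have cb : c = b.
  have mem : c =i b.
    by move=> x; apply/idP/idP; [exact: (last_ones_sub Mb Nc NP)|
                                 exact: (last_ones_sub Nc Mb MP)].
  apply: val_inj; exact: (irr_sorted_eq (@ltn_ord_trans n) (fun x => ltnn x) sc sb mem).
suff P1 : P = 1%:M by rewrite NP P1 mul1mx.
apply/matrixP => i k; rewrite mxE -N1 cb NP mxE (bigD1 k) //= M1 eqxx mulr1.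
by rewrite big1 ?addr0 // => a ak; rewrite M1 (negPf ak) mulr0.
Qed.

Lemma circ_eq (L N : Xi Fq m n) (g : 'M_n) (P : 'M_m) :
  P \in unitmx -> val N = P *m (val L *m g) -> circ L g = N.
Proof.
move=> Pu NP; rewrite /circ; case: pickP => [N' /existsP[Q /andP[Qu /eqP N'Q]]|]
  /=; last first.
  by move=> /(_ N)/existsP[]; exists P; rewrite Pu; apply/eqP.
have [/existsP[b Lb] /existsP[c Nc]] := (valP N, valP N').
apply: val_inj; apply: (row_equiv_last_ones (P := Q *m invmx P)) Lb Nc _ _.
  by rewrite unitmx_mul Qu unitmx_inv.
by rewrite NP -mulmxA mulKmx.
Qed.

Variable t : RStd n m.
Local Notation b := (tnth (row2 t)).

Lemma XP (L : Xi Fq m n) : reflect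
  ((forall i k, val L i (b k) = (i == k)%:R) /\
   (forall i (j : 'I_n), (b i < j)%N -> val L i j = 0))
  (L \in X Fq t).
Proof.
rewrite inE; apply: (iffP (last_onesP _ _)) => [[]|[]] //.
by split=> //; apply: row2_sorted.
Qed.

Lemma UwUP (g : 'M[Fq]_n) : reflect
  (unitri g /\ (forall i j, i \notin row2 t -> j \in row2 t -> g i j = 0))
  (g \in UwU Fq t).
Proof.
rewrite !inE; apply: (iffP andP) => [[/andP[g1 g0] gB]|[[g1 g0] gB]].
  split; first split=> [i|i j ij].
  - exact/eqP/(forallP g1).
  - by have /forallP/(_ i)/forallP/(_ j) := g0; rewrite ij => /eqP.
  move=> i j iB jB; have /forallP/(_ i)/forallP/(_ j) := gB.
  by rewrite iB jB => /eqP.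
split; first (apply/andP; split).
- by apply/forallP => i; rewrite g1.
- by apply/forallP => i; apply/forallP => j; apply/implyP => /g0->.
apply/forallP => i; apply/forallP => j; apply/implyP => /andP[iB jB].
by rewrite gB.
Qed.

Definition block2 (g : 'M[Fq]_n) : 'M[Fq]_m := mxsub b b g.

Lemma block2_unitri g : unitri g -> unitri (block2 g).
Proof.
move=> [g1 g0]; split=> [i|i j ij]; rewrite mxE //.
by rewrite g0 // tnth_row2_ltn.
Qed.

(** The columns of [M *m g] at the second-row letters form [block2 g], because
    those columns of [g] have no entry in a first-row row. *)
Lemma circ_X (M : Xi Fq m n) g : M \in X Fq t -> g \in UwU Fq t ->
  circ M g \in X Fq t /\ val (circ M g) = invmx (block2 g) *m val M *m g.
Proof.
move=> /XP[M1 M0] /UwUP[gu gB]; have hu := block2_unitri gu.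
have hU := unitri_unit hu; set h := block2 g in hu hU *.
pose N := invmx h *m val M *m g.
have MgB i k : (val M *m g) i (b k) = h i k.
  rewrite mxE mxE (bigD1 (b i)) //= M1 eqxx mul1r big1 ?addr0 // => j jb.
  have [/row2P[a ja]|jB] := boolP (j \in row2 t).
    by rewrite ja M1; rewrite ja tnth_row2_eq eq_sym in jb; rewrite (negPf jb) mul0r.
  by rewrite gB ?mulr0 ?mem_tnth.
have NE i j : N i j = \sum_a invmx h i a * (val M *m g) a j.
  by rewrite /N -mulmxA mxE.
have NX : last_ones N (row2 t).
  apply/last_onesP; split=> [|i k|i j ij]; first exact: row2_sorted.
    rewrite NE; under eq_bigr do rewrite MgB.
    by have := mulVmx hU => /matrixP/(_ i k); rewrite !mxE.
  rewrite NE big1 // => a _; have [ia|ai] := ltnP i a.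
    by rewrite (unitri_inv hu).2 ?mul0r.
  rewrite mxE big1 ?mulr0 // => l _.
  have [al|la] := ltnP (b a) l; first by rewrite M0 ?mul0r.
  rewrite gu.2 ?mulr0 // (leq_ltn_trans la) // (leq_ltn_trans _ ij) //.
  by rewrite leqNgt tnth_row2_ltn -leqNgt.
have NXi : in_Xi N by apply/existsP; exists (row2 t).
have -> : circ M g = exist _ N NXi.
  by apply: (@circ_eq _ _ _ (invmx h)); rewrite ?unitmx_inv // mulmxA.
by rewrite inE.
Qed.

End EchelonForms.

(** * Character sums and their lines *)

Section CharacterVectors.
Variables (Fq : finFieldType) (F : fieldType) (m n : nat) (t : RStd n m).
Variables (theta : Fq -> F) (htheta : nontrivial_character theta).
Local Notation b := (tnth (row2 t)).
Implicit Types (L M N : Xi Fq m n) (A K : 'M[Fq]_(m, n)).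

Definition restrictJ A : 'M[Fq]_(m, n) :=
  \matrix_(i, j) if (b i, j) \in J t then A i j else 0.

Definition pairing (A B : 'M[Fq]_(m, n)) : Fq := \sum_i \sum_j A i j * B i j.

Lemma pairing_trace A B : pairing A B = \tr (A *m B^T).
Proof.
by apply: eq_bigr => i _; rewrite mxE; apply: eq_bigr => j _; rewrite mxE.
Qed.

Lemma in_J i j : ((b i, j) \in J t) = (j < b i)%N && (j \notin row2 t).
Proof. by rewrite inE /= mem_tnth. Qed.

Lemma X_offJ L i j : L \in X Fq t -> (b i, j) \notin J t ->
  val L i j = (j == b i)%:R.
Proof.
move=> /XP[L1 L0]; rewrite in_J negb_and negbK => /orP[|/row2P[k ->]].
  rewrite -leqNgt leq_eqVlt => /predU1P[/val_inj<-|lt].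
    by rewrite L1 !eqxx.
  by rewrite L0 // -(inj_eq val_inj) gtn_eqF.
by rewrite L1 tnth_row2_eq eq_sym.
Qed.

Lemma X_extend K : exists2 L, L \in X Fq t & restrictJ (val L) = restrictJ K.
Proof.
pose A : 'M[Fq]_(m, n) :=
  \matrix_(i, j) if (b i, j) \in J t then K i j else (j == b i)%:R.
have AX : last_ones A (row2 t).
  apply/last_onesP; split=> [|i k|i j ij]; first exact: row2_sorted.
    by rewrite mxE in_J mem_tnth andbF tnth_row2_eq eq_sym.
  by rewrite mxE in_J ltnNge (ltnW ij) /= -(inj_eq val_inj) gtn_eqF.
have AXi : in_Xi A by apply/existsP; exists (row2 t).
exists (exist _ A AXi); first by rewrite inE.
by apply/matrixP => i j; rewrite !mxE; case: ifP => //= ijJ; rewrite ijJ.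
Qed.

Lemma X_restrictJ_inj L N : L \in X Fq t -> N \in X Fq t ->
  restrictJ (val L) = restrictJ (val N) -> L = N.
Proof.
move=> LX NX /matrixP E; apply: val_inj; apply/matrixP => i j.
have := E i j; rewrite !mxE; case: ifP => // /negbT nJ _.
by rewrite !X_offJ.
Qed.

Lemma theta0 : theta 0 = 1.
Proof.
have [nz thD _] := htheta; apply: (mulfI (nz 0)).
by rewrite -thD addr0 mulr1.
Qed.

Lemma theta_sum (I : finType) (P : pred I) (f : I -> Fq) :
  theta (\sum_(i | P i) f i) = \prod_(i | P i) theta (f i).
Proof. by have [_ thD _] := htheta; apply: (big_morph theta thD theta0). Qed.

(** The coefficients of e_L are a multiple of the additive character
    M |-> theta (- <L, M>) of the affine space X_t. *)
Lemma e_val L N : e theta t L N =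
  #|Fq|%:R ^- #|J t| *
  (N \in X Fq t)%:R * theta (- pairing (restrictJ (val L)) (val N)).
Proof.
have psiE M : \prod_(i < m) \prod_(j < n | (b i, j) \in J t)
    theta (- (val L i j * val M i j)) =
    theta (- pairing (restrictJ (val L)) (val M)).
  rewrite /pairing -sumrN theta_sum; apply: eq_bigr => i _.
  rewrite -sumrN theta_sum [LHS]big_mkcond; apply: eq_bigr => j _.
  by rewrite mxE; case: ifP => // _; rewrite mul0r oppr0 theta0.
rewrite /e ffunE -mulrA; congr (_ * _); rewrite sum_ffunE.
under eq_bigr do rewrite psiE ffunE ffunE.
have [NX|NX] := boolP (N \in X Fq t); last first.
  rewrite mul0r big1 // => M MX; case: eqP => [NM|]; last by rewrite scaler0.
  by rewrite NM MX in NX.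
rewrite mul1r (bigD1 N) //= eqxx big1 ?addr0 => [|M /andP[_ /negPf]].
  exact: mulr1.
by rewrite eq_sym => ->; rewrite scaler0.
Qed.

Lemma act_val (v : Mlam Fq F m n) g N :
  act v g N = \sum_(M | circ M g == N) v M.
Proof.
rewrite sum_ffunE [RHS]big_mkcond; apply: eq_bigr => M _; rewrite !ffunE.
by rewrite eq_sym; case: eqP => _; [exact: mulr1|exact: mulr0].
Qed.

(** Substituting M = h N g^-1 in the character sum gives
    <L, M> = tr (L M^T) = <K, N> with K = h^T L g^-T, where L stands for its part
    on J_t.  The entries of N outside J_t
    are constant, so the part of K there only contributes the scalar. *)
Lemma act_e L g : L \in X Fq t -> g \in UwU Fq t ->
  exists L' c, [/\ L' \in X Fq t, c != 0, act (e theta t L) g = c *: e theta t L' &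
    restrictJ (val L') =
    restrictJ ((block2 t g)^T *m restrictJ (val L) *m (invmx g)^T)].
Proof.
move=> LX gU; set h := block2 t g; set K := _ *m _ *m _.
have [L' L'X L'K] := X_extend K.
have gu : g \in unitmx by have /UwUP[/unitri_unit] := gU.
have hu : h \in unitmx by have /UwUP[/(block2_unitri t)/unitri_unit] := gU.
have [nz thD _] := htheta.
have circK M : M \in X Fq t -> val M = h *m val (circ M g) *m invmx g.
  by move=> MX; rewrite (circ_X MX gU).2 !mulmxA mulmxV // mul1mx mulmxK.
have circ_inj : {in X Fq t &, injective (fun M => circ M g)}.
  by move=> M M' MX M'X /= E; apply: val_inj; rewrite circK // E -circK.
have circ_onto N : N \in X Fq t -> exists2 M, M \in X Fq t & circ M g = N.
  move=> NX; have sub : [set circ M g | M in X Fq t]%SET \subset X Fq t.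
    by apply/fintype.subsetP => _ /imsetP[M MX ->]; have [] := circ_X MX gU.
  have : [set circ M g | M in X Fq t]%SET == X Fq t.
    by rewrite eqEcard sub (card_in_imset circ_inj) leqnn.
  by move/eqP/setP/(_ N); rewrite NX => /imsetP[M MX ->]; exists M.
exists L', (theta (- \sum_i K i (b i))); split=> //; apply/ffunP => N.
rewrite act_val ffunE e_val.
have [NX|NX] := boolP (N \in X Fq t); last first.
  rewrite mulr0 mul0r scaler0; apply: big1 => M /eqP MN; rewrite e_val.
  have [MX|_] := boolP (M \in X Fq t); last by rewrite mulr0 mul0r.
  by have [] := circ_X MX gU; rewrite MN (negPf NX).
have [M0 M0X M0N] := circ_onto N NX.
rewrite (bigD1 M0) ?M0N //= big1 ?addr0 => [|M /andP[/eqP MN MM0]]; last first.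
  rewrite e_val; case: (boolP (M \in X Fq t)) => [MX|_].
    by move: MM0; rewrite (circ_inj M M0 MX M0X) ?eqxx //= MN M0N.
  by rewrite mulr0 mul0r.
rewrite e_val M0X /= mulr1.
suff -> : pairing (restrictJ (val L)) (val M0) =
    pairing (restrictJ (val L')) (val N) + \sum_i K i (b i).
  by rewrite opprD thD [_ *: _]mulrC !mulrA.
have -> : pairing (restrictJ (val L)) (val M0) = pairing K (val N).
  rewrite !pairing_trace (circK M0 M0X) M0N !trmx_mul !mulmxA.
  by rewrite [LHS]mxtrace_mulC /K !mulmxA.
rewrite /pairing -big_split /=; apply: eq_bigr => i _.
rewrite L'K (bigD1 (b i)) //= [in RHS](bigD1 (b i)) //=.
have bJ : (b i, b i) \in J t = false by rewrite in_J ltnn.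
rewrite [restrictJ _ _ _]mxE bJ mul0r add0r X_offJ ?bJ // eqxx mulr1 addrC.
congr (_ + _); apply: eq_bigr => j jb; rewrite [restrictJ _ _ _]mxE.
case: ifP => // /negbT nJ.
by rewrite X_offJ // (negPf jb) mulr0 mul0r.
Qed.

Hypothesis q_neq0 : #|Fq|%:R != 0 :> F.

(** The coefficient at the matrix vanishing on J_t fixes the scalar, and the
    coefficients at multiples of one matrix unit then separate L from L' since
    theta is nontrivial. *)
Lemma e_proportional L L' (c c' : F) : L \in X Fq t -> L' \in X Fq t ->
  c != 0 -> c *: e theta t L = c' *: e theta t L' -> L = L'.
Proof.
move=> LX L'X c0 /ffunP eqe; have [nz thD [x0 x01]] := htheta.
have {}eqe N : N \in X Fq t ->
    c * theta (- pairing (restrictJ (val L)) (val N)) =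
    c' * theta (- pairing (restrictJ (val L')) (val N)).
  move=> NX; have := eqe N; rewrite [LHS]ffunE [RHS]ffunE !e_val NX mulr1.
  rewrite ![_ *: _]mulrCA; apply: mulfI.
  by rewrite invr_eq0 expf_neq0.
have pairJ A B : pairing (restrictJ A) B = pairing (restrictJ A) (restrictJ B).
  apply: eq_bigr => i _; apply: eq_bigr => j _; rewrite !mxE.
  by case: ifP; rewrite ?mul0r.
have {}eqe B : c * theta (- pairing (restrictJ (val L)) (restrictJ B)) =
    c' * theta (- pairing (restrictJ (val L')) (restrictJ B)).
  by have [N NX NB] := X_extend B; have := eqe N NX; rewrite pairJ [in RHS]pairJ NB.
have cc' : c = c'.
  have := eqe 0; have -> : restrictJ 0 = 0.
    by apply/matrixP => i j; rewrite !mxE; case: ifP.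
  have P0 A : pairing A 0 = 0 by rewrite pairing_trace trmx0 mulmx0 linear0.
  by rewrite !P0 oppr0 theta0 !mulr1.
apply: X_restrictJ_inj => //; apply/matrixP => i j.
rewrite [LHS]mxE [RHS]mxE; case: ifP => // ijJ.
(* If l and l' differ, the entry y makes theta take the value theta x0 <> 1 on
   the difference of the two pairings. *)
set l := val L i j; set l' := val L' i j; apply/eqP; rewrite -subr_eq0.
apply: contraNT x01 => ll'; apply/eqP; pose y := x0 / (l' - l).
have pairD A : pairing (restrictJ A) (restrictJ (y *: delta_mx i j)) = A i j * y.
  rewrite -pairJ /pairing (bigD1 i) //= (bigD1 j) //= !mxE ijJ !eqxx mulr1.
  rewrite !big1 ?addr0 // => [i' /negPf i'i|j' /negPf j'j]; last first.
    by rewrite !mxE eqxx j'j !mulr0.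
  by rewrite big1 // => j' _; rewrite !mxE i'i !mulr0.
have := eqe (y *: delta_mx i j); rewrite !pairD -/l -/l' -cc' => /(mulfI c0).
have -> : - (l * y) = - (l' * y) + x0.
  have -> : x0 = l' * y - l * y; last by rewrite addKr.
  by rewrite -mulrBl mulrC divfK // subr_eq0 eq_sym -subr_eq0.
by rewrite thD => ll; apply: (mulfI (nz (- (l' * y)))); rewrite ll mulr1.
Qed.
End CharacterVectors.

(** * South-west rectangles and pattern matrices *)

Section Orbits.
Variables (Fq : finFieldType) (m n : nat) (t : RStd n m).
Local Notation b := (tnth (row2 t)).
Implicit Types (A : 'M[Fq]_(m, n)) (L : Xi Fq m n) (k : nat).

Definition rows_from k : {set 'I_m} := [set i : 'I_m | (k <= b i)%N]%SET.
Definition cols_to k : {set 'I_n} := [set j : 'I_n | (j < k)%N & j \notin row2 t]%SET.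
(** The matrix attached to the corner after [k] steps, padded with zeros so that
    all corners and all fillings share one type. *)
Definition rect k A := proj Fq (rows_from k) *m A *m proj Fq (cols_to k).

Lemma rectE k A i j :
  rect k A i j = ((k <= b i)%N && (j < k)%N && (j \notin row2 t))%:R * restrictJ t A i j.
Proof.
rewrite mul_projE proj_mulE !inE mxE in_J.
case: (leqP k (b i)) => [kb|]; last by rewrite !mul0r.
case: (ltnP j k) => [jk|]; last by rewrite mulr0 mul0r.
rewrite (leq_trans jk kb) /= mul1r.
by case: (_ \notin _); rewrite ?mulr1 ?mul1r ?mulr0 ?mul0r.
Qed.

Lemma rect_restrictJ k A A' : restrictJ t A = restrictJ t A' -> rect k A = rect k A'.
Proof. by move=> E; apply/matrixP => i j; rewrite !rectE E. Qed.

Lemma restrictJ_idem A : restrictJ t (restrictJ t A) = restrictJ t A.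
Proof. by apply/matrixP => i j; rewrite !mxE; case: ifP => // ->. Qed.

Lemma rank_corner_mx k A :
  \rank (corner_mx t A ((below k (row2 t)).+1, (below k (row1 t)).+1)) =
  \rank (rect k A).
Proof.
set c := (_, _).
pose f (r : 'I_#|corner_rows m c|) := enum_val r.
pose g (r : 'I_#|corner_cols m n c|) := tnth (row1 t) (enum_val r).
have -> : corner_mx t A c = mxsub f g A by apply/matrixP => i j; rewrite !mxE.
have f_inj : injective f by apply: enum_val_inj.
have r1_inj : injective (tnth (row1 t)) by apply/tuple_uniqP/row1_uniq.
have g_inj : injective g by move=> x y /r1_inj/enum_val_inj.
rewrite rank_mxsub // /rect; congr (\rank (proj _ _ *m _ *m proj _ _)).
  apply/setP => i.
  have -> : (i \in rows_from k) = (i \in corner_rows m c).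
    rewrite !inE /= ltnS leqNgt [RHS]leqNgt (tnth_nth (b i)); congr (~~ _).
    by rewrite nth_ltn_below ?row2_sorted ?size_tuple.
  apply/imsetP/idP => [[r _ ->]|ic]; first exact: enum_valP.
  by exists (enum_rank_in ic i); rewrite // /f enum_rankK_in.
apply/setP => x; rewrite inE -mem_row1.
have H i : (tnth (row1 t) i < k)%N = (i \in corner_cols m n c).
  rewrite inE /= ltnS (tnth_nth (tnth (row1 t) i)).
  by rewrite nth_ltn_below ?row1_sorted ?size_tuple.
apply/imsetP/andP => [[r _ ->]|[xk /tnthP[i xi]]].
  by rewrite H enum_valP mem_tnth.
have ic : i \in corner_cols m n c by rewrite -H -xi.
by exists (enum_rank_in ic i); rewrite // /g enum_rankK_in.
Qed.

Lemma goodP A : good t A <-> forall k, (k <= n)%N ->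
  (\rank (rect k A) + below k (row2 t) <= below k (row1 t))%N.
Proof.
split=> [gA k kn|H c /path_cornersP[k kn ->]].
  have ck : ((below k (row2 t)).+1, (below k (row1 t)).+1) \in path_corners t.
    by apply/path_cornersP; exists k.
  by have := gA _ ck; rewrite rank_corner_mx /=; lia.
by rewrite rank_corner_mx /=; have := H k kn; lia.
Qed.

Lemma UwU_inv g : g \in UwU Fq t -> invmx g \in UwU Fq t.
Proof.
move=> /UwUP[gu gB]; apply/UwUP; split; first exact: unitri_inv.
move=> i j iB jB; apply: (@unitri_inv_vanish _ _ _
  (fun i j => i \notin row2 t /\ j \in row2 t)) => // [{iB jB}i {}j [iB jB]|].
  by apply: contraNneq iB => ->.
move=> {iB jB}i a {}j _ gia [iB jB]; split=> //.
by apply: contra_neqN gia; apply: gB.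
Qed.

(** Upper unitriangular row operations add lower rows to upper ones, so they
    preserve the set of rows b_i >= k.  Column operations move to the right, and
    those given by g^-T never feed a second-row column into a first-row one, so
    they preserve the set of first-row columns < k. *)
Lemma rank_rect_orbit k L L' g : g \in UwU Fq t ->
  restrictJ t (val L') =
    restrictJ t ((block2 t g)^T *m restrictJ t (val L) *m (invmx g)^T) ->
  \rank (rect k (val L')) = \rank (rect k (val L)).
Proof.
move=> gU /(@rect_restrictJ k)->.
rewrite -(rect_restrictJ k (restrictJ_idem (val L))).
have /UwUP[gu gB] := gU; have /UwUP[g'u g'B] := UwU_inv gU.
have hu := block2_unitri t gu; have h'u := unitri_inv hu.
have rows h : unitri h -> proj Fq (rows_from k) *m h^T =
    proj Fq (rows_from k) *m h^T *m proj Fq (rows_from k).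
  move=> [_ h0]; apply: proj_mul_absorb => i j; rewrite !inE -ltnNge mxE => ki jk.
  by rewrite h0 // -(tnth_row2_ltn t) (leq_trans jk).
have cols f : unitri f -> (forall i j, i \notin row2 t -> j \in row2 t -> f i j = 0) ->
    f^T *m proj Fq (cols_to k) = proj Fq (cols_to k) *m f^T *m proj Fq (cols_to k).
  move=> [_ f0] fB; apply: mul_proj_absorb => i j; rewrite !inE mxE => iC /andP[jk jB].
  have [ik|ki] := ltnP i k; last by rewrite f0 // (leq_trans jk).
  by move: iC; rewrite ik negbK; apply: fB.
apply: (@rank_stable _ _ _ _ (invmx (block2 t g))^T _ _ g^T); rewrite ?proj_idem //.
- by rewrite -trmx_mul mulmxV ?trmx1 // unitri_unit.
- by rewrite -trmx_mul mulmxV ?trmx1 // unitri_unit.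
- exact: rows.
- exact: rows.
- exact: cols.
- exact: cols.
Qed.

Lemma X_offdiag L i j : L \in X Fq t ->
  (j != b i) && (val L i j != 0) = (restrictJ t (val L) i j != 0).
Proof.
move=> LX; rewrite mxE; case: ifP => [|/negbT nJ].
  by rewrite in_J => /andP[jb _]; rewrite -(inj_eq val_inj) ltn_eqF.
rewrite (X_offJ LX nJ) eqxx; case: (j == b i) => //=.
by rewrite eqxx.
Qed.

Lemma pattern_matrixP L : L \in X Fq t ->
  reflect (monomial (restrictJ t (val L))) (pattern_matrix t (val L)).
Proof.
move=> LX; apply: (iffP andP) => [[/forallP rowP /forallP colP]|[rowP colP]].
  split=> [i j j'|i i' j]; rewrite -!X_offdiag // => H H'.
    by apply: (card_le1_eqP (rowP i)); rewrite inE.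
  by apply: (card_le1_eqP (colP j)); rewrite inE.
split; apply/forallP => x; apply/card_le1_eqP => y z; rewrite !inE !X_offdiag //.
  by move=> H H'; apply: rowP H' H.
by move=> H H'; apply: colP H' H.
Qed.

Lemma mem_pattern L i j :
  ((b i, j) \in pattern t (val L)) = (restrictJ t (val L) i j != 0).
Proof.
rewrite inE mxE /=; case: ifP => ijJ; last by rewrite eqxx.
apply/existsP/idP => [[i' /andP[]]|ij]; last by exists i; rewrite eqxx.
by rewrite tnth_row2_eq => /eqP->.
Qed.

Lemma pattern_rows L x : x \in pattern t (val L) -> exists i, x.1 = b i.
Proof. by rewrite !inE => /andP[/and3P[_ /row2P]]. Qed.

Lemma pattern_injective L : monomial (restrictJ t (val L)) ->
  {in pattern t (val L) &, injective fst} /\ {in pattern t (val L) &, injective snd}.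
Proof.
move=> [rowP colP]; split=> -[x1 x2] [y1 y2] xp yp /=.
  have [i /= xi] := pattern_rows xp; move: xp yp; rewrite xi => + + e.
  by rewrite -e !mem_pattern => xp yp; rewrite (rowP _ _ _ xp yp).
have [i /= xi] := pattern_rows xp; have [i' /= yi] := pattern_rows yp.
move: xp yp; rewrite xi yi => + + e.
by rewrite -e !mem_pattern => xp yp; rewrite (colP _ _ _ xp yp).
Qed.

Lemma rank_rect_pattern k L : monomial (restrictJ t (val L)) ->
  \rank (rect k (val L)) =
  #|[set x in pattern t (val L) | (x.2 < k <= x.1)%N]%SET|.
Proof.
move=> Lm; have [inj1 _] := pattern_injective Lm; have [rowP colP] := Lm.
have rect_neq0 i j : (rect k (val L) i j != 0) =
    ((b i, j) \in [set x in pattern t (val L) | (x.2 < k <= x.1)%N]%SET).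
  rewrite rectE inE mem_pattern mulf_eq0 negb_or /=.
  have [|] := boolP (restrictJ _ _ _ _ != 0); last by rewrite andbF.
  rewrite mxE in_J; case: ifP; rewrite ?eqxx // => /andP[_ ->] _.
  by case: (k <= b i)%N; case: (j < k)%N; rewrite ?oner_eq0 ?eqxx.
rewrite rank_monomial; last first.
  split=> [i j j'|i i' j]; rewrite !rect_neq0 inE mem_pattern => /andP[H _];
    rewrite inE mem_pattern => /andP[H' _]; [exact: rowP H H'|exact: colP H H'].
rewrite -(card_imset _ (@tnth_row2_inj _ _ t)) -[RHS](@card_in_imset _ _ fst).
  apply: eq_card => y; apply/imsetP/imsetP => [[i]|[[x j] xP ->]].
    by rewrite inE => /existsP[j]; rewrite rect_neq0 => ? ->; exists (b i, j).
  have /setIdP[/pattern_rows[i /= xi] _] := xP.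
  by exists i; rewrite // inE; apply/existsP; exists j; rewrite rect_neq0 -xi.
by move=> x y /setIdP[xp _] /setIdP[yp _]; apply: inj1.
Qed.

(** Bruhat elimination gives [h] and [w].  The matrix [W] has the block of [w] on
    the first-row letters, and [invmx h] as its block on the second-row letters,
    so that its inverse lies in U^w :&: U, has second-row block [h], and acts on
    the entries in J_t as [h] and [w] do. *)
Lemma exists_pattern_rep L : L \in X Fq t -> exists2 g, g \in UwU Fq t &
  monomial (restrictJ t ((block2 t g)^T *m restrictJ t (val L) *m (invmx g)^T)).
Proof.
move=> LX; set A := restrictJ t (val L).
have [h [w [hu wu [rowP colP]]]] := bruhat A.
pose S1 : {set 'I_n} := [set x | x \notin row2 t]%SET.
pose Eb : 'M[Fq]_(m, n) := rowsub b 1%:M.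
have EbE i j : Eb i j = (b i == j)%:R by rewrite !mxE.
pose W := proj Fq S1 *m w *m proj Fq S1 + Eb^T *m invmx h *m Eb.
have W1 i j : i \notin row2 t ->
    W i j = w i j * (j \notin row2 t)%:R.
  move=> iB; rewrite mxE mul_projE proj_mulE !inE iB mul1r.
  rewrite [X in _ + X](_ : _ = 0) ?addr0 // -mulmxA mxE big1 // => a _.
  by rewrite mxE EbE; case: eqP iB => [<-|_ _]; rewrite ?mem_tnth ?mul0r.
have EW : Eb *m W = invmx h *m Eb.
  rewrite mulmxDr !mulmxA rowsub1_mul_tr ?mul1mx; last exact: tnth_row2_inj.
  rewrite [X in X + _](_ : _ = 0) ?add0r // (_ : Eb *m proj _ _ = 0) ?mul0mx //.
  apply/matrixP => i j; rewrite mul_projE EbE inE mxE.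
  by case: eqP => [<-|_]; rewrite ?mul0r // mem_tnth mulr0.
have W2 i j : W (b i) j = (invmx h *m Eb) i j.
  rewrite -EW [RHS]mxE (bigD1 (b i)) //= EbE eqxx mul1r big1 ?addr0 // => a.
  by rewrite EbE eq_sym => /negPf->; rewrite mul0r.
have W22 i (k' : 'I_m) : W (b i) (b k') = invmx h i k'.
  rewrite W2 mxE (bigD1 k') //= EbE eqxx mulr1 big1 ?addr0 // => a ak.
  by rewrite EbE tnth_row2_eq (negPf ak) mulr0.
have h'u := unitri_inv hu.
have WU : W \in UwU Fq t.
  apply/UwUP; split=> [|i j iB jB]; last by rewrite W1 // jB mulr0.
  split=> [i|i j ij].
    have [/row2P[a ->]|iB] := boolP (i \in row2 t); first by rewrite W22 h'u.1.
    by rewrite W1 // iB wu.1 mulr1.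
  have [/row2P[a ia]|iB] := boolP (i \in row2 t); last by rewrite W1 // wu.2 ?mul0r.
  rewrite ia; have [/row2P[c jc]|jB] := boolP (j \in row2 t).
    by rewrite jc W22 h'u.2 // -(tnth_row2_ltn t) -ia -jc.
  rewrite W2 mxE big1 // => c _; rewrite EbE.
  by case: eqP jB => [<-|_ _]; rewrite ?mem_tnth ?mulr0.
have Wu : W \in unitmx by have /UwUP[/unitri_unit] := WU.
have hU := unitri_unit hu.
exists (invmx W); first exact: UwU_inv.
have -> : block2 t (invmx W) = h.
  rewrite /block2 mxsub_pinching -/Eb.
  have -> : Eb *m invmx W = h *m Eb.
    by rewrite -{1}[Eb](mulKVmx hU) -EW mulmxA mulmxK.
  by rewrite -mulmxA rowsub1_mul_tr ?mulmx1 //; apply: tnth_row2_inj.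
rewrite invmxK.
have E i j : restrictJ t (h^T *m A *m W^T) i j != 0 -> (h^T *m A *m w^T) i j != 0.
  rewrite mxE in_J; case: ifP => [/andP[_ jB]|]; last by rewrite eqxx.
  suff -> : (h^T *m A *m W^T) i j = (h^T *m A *m w^T) i j by [].
  rewrite [LHS]mxE [RHS]mxE; apply: eq_bigr => l _.
  rewrite [W^T _ _]mxE [w^T _ _]mxE W1 //.
  have [lB|] := boolP (l \in row2 t); last by rewrite mulr1.
  suff -> : (h^T *m A) i l = 0 by rewrite !mul0r.
  rewrite mxE big1 // => a _.
  by rewrite [A _ _]mxE in_J lB andbF mulr0.
by split=> [i j j' /E H /E|i i' j /E H /E]; [apply: rowP|apply: colP].
Qed.

End Orbits.

(** * Good fillings and standardness *)

(** #|Fq| is a power of [p]. *)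
Lemma card_neq0 (Fq : finFieldType) (F : fieldType) p :
  p \in [pchar Fq] -> p \notin [pchar F] -> #|Fq|%:R != 0 :> F.
Proof.
move=> hp hF; have /p_natP[k ->] : p.-nat #|Fq|.
  by rewrite -cardsT; apply: abelem_pgroup (fin_ring_pchar_abelem hp).
rewrite natrX expf_neq0 //; apply: contra hF => pF0.
by rewrite inE pF0 andbT (pcharf_prime hp).
Qed.

Unset Implicit Arguments.

Theorem theorem3p4p5 (Fq : finFieldType) (F : fieldType) (p n m : nat)
    (hp : p \in [pchar Fq]) (hF : p \notin [pchar F])
    (hz : exists z : F, p.-primitive_root z)
    (theta : Fq -> F) (htheta : nontrivial_character theta)
    (hm : (m.*2 <= n)%N) (t : RStd n m)
    (O : set (Mlam Fq F m n)) (hO : is_orbit theta t O)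
    (L : Xi Fq m n) (hL : L \in X Fq t) (heL : O (e theta t L)) :
  good t (val L) <->
  standard
    (delete t (pI (orbit_pattern theta t O) :|: pJ (orbit_pattern theta t O))).
Proof.
have q0 := card_neq0 hp hF.
have [v [L1 L1X <-] OE] := hO.
have inO N : N \in X Fq t -> O (e theta t N) -> exists2 g, g \in UwU Fq t &
    restrictJ t (val N) =
    restrictJ t ((block2 t g)^T *m restrictJ t (val L1) *m (invmx g)^T).
  move=> NX; rewrite OE => -[_ [g [c [gU c0 gN]]]].
  have [L' [c' [L'X _ gL' L'E]]] := act_e htheta L1X gU.
  exists g => //; rewrite (e_proportional htheta q0 NX L'X c0 (c' := c')) //.
  by rewrite -gN.
(* Both L and the pattern matrix of the orbit are compared with the matrix L1
   that generates it. *)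
have rankO N k : N \in X Fq t -> O (e theta t N) ->
    \rank (rect t k (val N)) = \rank (rect t k (val L1)).
  by move=> NX /(inO N NX)[g gU]; apply: rank_rect_orbit.
have [L0 [[L0X L0P L0O] pE]] : exists L0, [/\ L0 \in X Fq t,
    pattern_matrix t (val L0) & O (e theta t L0)] /\
    pattern t (val L0) = orbit_pattern theta t O.
  suff: ([set pattern t (val L0) | L0 in [set L0 : Xi Fq m n |
      [/\ L0 \in X Fq t, pattern_matrix t (val L0) & O (e theta t L0)]]]%classic)
      (orbit_pattern theta t O) by case=> L0 H <-; exists L0.
  apply: xgetPex; have [g gU gM] := exists_pattern_rep L1X.
  have [L' [c [L'X c0 gL' L'E]]] := act_e htheta L1X gU.
  exists (pattern t (val L')), L' => //; split=> //.
    by apply/(pattern_matrixP L'X); rewrite L'E.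
  by rewrite OE; split; [exists L'|exists g, c].
have /(pattern_matrixP L0X) L0M := L0P.
have [inj1 inj2] := pattern_injective L0M.
rewrite -pE standard_delete //; last first.
  by apply/fintype.subsetP => x /setIdP[].
rewrite goodP; split=> H k /H;
  by rewrite (rankO _ _ hL heL) -(rankO _ _ L0X L0O) rank_rect_pattern.
Qed.
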